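(* Let $B$ be a quadratic real division algebra of dimension at least two, let $T:B\to B$ be a planar map, determined by the linear form $\sigma:\operatorname{Im}B\to\mathbb{R}$ and the scalar $\lambda\in\mathbb{R}\setminus\{0\}$, and let $S=\max\{\sigma(x)\mid x\in\operatorname{Im} B,\ x^2=-1_B\}$ (square taken in $B$). Then the planar isotope $A=B_T$ has a unique non-zero idempotent if and only if either $$\lambda>(S^2+1)/2,\qquad\text{or}\qquad S=0\ \text{ and }\ \lambda=1/2.$$
   Context: An algebra is a finite-dimensional real vector space with a bilinear multiplication (not necessarily associative, commutative or unital). A subalgebra is a linear subspace closed under multiplication. A division algebra is an algebra $A$ in which $x\mapsto ax$ and $x\mapsto xa$ are bijective for every non-zero $a\in A$. An algebra $B$ is quadratic if it has an identity element $1_B\neq0$ and $1_B,x,x^2$ are linearly dependent for all $x\in B$. For a quadratic algebra $B$, $\operatorname{Im}B=\{x\in B\setminus\mathbb{R}1_B\mid x^2\in\mathbb{R}1_B\}\cup\{0\}$, which is a linear subspace with $B=\mathbb{R}1_B\oplus\operatorname{Im}B$. For a quadratic division algebra $B$, a linear map $T:B\to B$ is planar if it is invertible, $T(1_B)=1_B$, and every subalgebra of $B$ is invariant under $T$. Every planar map has the form $T(1_B)=1_B$, $T(v)=\sigma(v)1_B+\lambda v$ for $v\in\operatorname{Im}B$, for a linear form $\sigma:\operatorname{Im}B\to\mathbb{R}$ and a scalar $\lambda\in\mathbb{R}\setminus\{0\}$; one says $T$ is determined by $\sigma$ and $\lambda$. The planar isotope $B_T$ is the vector space $B$ with multiplication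 $x\circ y=(Tx)(Ty)$. *)

(* Defs.v *)
From HB Require Import structures.
From mathcomp Require Import all_boot all_order all_algebra.
From mathcomp Require Import classical_sets reals.

Set Implicit Arguments.
Unset Strict Implicit.
Unset Printing Implicit Defensive.

Import Order.TTheory GRing.Theory Num.Theory.
Local Open Scope ring_scope.
Local Open Scope classical_set_scope.

(* A real algebra is a vectType B over R : realType together with a bilinear
   multiplication mul : {bilinear B -> B -> B}; no associativity, commutativity
   or identity is assumed. *)

Section Algebra.
Variables (R : realType) (B : vectType R).
Implicit Types (mul : {bilinear B -> B -> B}) (one : B) (T : 'End(B)).

Definition division_algebra mul : Prop :=
  forall a : B, a != 0 -> bijective (fun x => mul a x) /\
                          bijective (fun x => mul x a).

Definition is_identity mul one : Prop :=
  forall x : B, mul one x = x /\ mul x one = x.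

(* [free] sees a sequence with its repetitions, so that for instance
   [:: one; x; mul x x] is not free when x = one. *)
Definition quadratic_algebra mul one : Prop :=
  [/\ one != 0, is_identity mul one &
      forall x : B, ~~ free [:: one; x; mul x x]].

Definition ImB mul one : {pred B} :=
  [pred x | (x \notin <[one]>%VS) && (mul x x \in <[one]>%VS) || (x == 0)].

Definition subalgebra mul (U : {vspace B}) : Prop :=
  {in U &, forall x y, mul x y \in U}.

Definition planar mul one T : Prop :=
  [/\ bijective T, T one = one &
      forall U : {vspace B}, subalgebra mul U -> (T @: U <= U)%VS].

(* A linear form on the subspace D is represented by a function on all of B
   whose values outside D are irrelevant. *)
Definition linear_form_on (D : {pred B}) (sigma : B -> R) : Prop :=
  forall a : R, {in D &, forall x y, sigma (a *: x + y) = a * sigma x + sigma y}.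

Definition determined_by mul one T (sigma : B -> R) (lambda : R) : Prop :=
  T one = one /\
  {in ImB mul one, forall v, T v = sigma v *: one + lambda *: v}.

Definition isotope_mul mul T (x y : B) : B := mul (T x) (T y).

Lemma isotope_mul_bilinear mul T :
  bilinear_for *:%R *:%R (isotope_mul mul T).
Proof.
by split=> z a x y; rewrite /isotope_mul linearP ?linearPl ?linearPr.
Qed.

HB.instance Definition _ mul T :=
  bilinear_isBilinear.Build R B B B *:%R *:%R (isotope_mul mul T)
    (isotope_mul_bilinear mul T).

Definition planar_isotope mul T : {bilinear B -> B -> B} := isotope_mul mul T.

Definition nonzero_idempotent mul (x : B) : Prop := x != 0 /\ mul x x = x.

End Algebra.

Definition is_max (R : realType) (X : set R) (S : R) : Prop :=
  X S /\ ubound X S.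

(* Main.v *)
(** In a quadratic division algebra the squares of non-zero imaginary elements
    are negative multiples of [one], which makes [B] a Euclidean space in which
    [sigma] is represented by a vector [w]; hence [S = |w|].  For an imaginary
    [u] with [u^2 = - one], the element [a one + s u] with [s != 0] is idempotent
    in the isotope iff [a + s sigma(u) = 1 / (2 lambda)] and
    [lambda^2 s^2 - s sigma(u) + (2 lambda - 1) / (4 lambda^2) = 0].  This has a
    real root iff [sigma(u)^2 + 1 - 2 lambda >= 0], and such a root can be chosen
    non-zero unless [sigma(u) = 0] and [lambda = 1/2].  As [one] is always
    idempotent, uniqueness means that no [u] yields a non-zero root, which is
    decided at the [u] maximizing [sigma]. *)

From HB Require Import structures.
Require Import Defs.
From mathcomp Require Import all_boot all_order all_algebra.
From mathcomp Require Import classical_sets reals.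
From mathcomp Require Import ring lra.

Set Implicit Arguments.
Unset Strict Implicit.
Unset Printing Implicit Defensive.

Import Order.TTheory GRing.Theory Num.Theory.
Local Open Scope ring_scope.
Local Open Scope classical_set_scope.

(** * Representing a linear form by a bilinear form *)

(** Sending [w] to the row of the values [g e_i w] on a basis is linear. It is injective because
    [g x x = 0] forces [x = 0], hence surjective by dimension, so the row of the values [f e_i] has
    a preimage. *)
Lemma scalar_form_represented (F : fieldType) (V : vectType F)
    (g : V -> V -> F) (f : V -> F) :
  (forall y, scalar (g^~ y)) -> (forall x, scalar (g x)) ->
  (forall x, g x x = 0 -> x = 0) -> scalar f ->
  exists w, forall x, f x = g x w.
Proof.
move=> gl gr g0 fl.
pose e := vbasis {:V}.
have form_eq (h k : V -> F) : scalar h -> scalar k ->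
    (forall i : 'I_(\dim {:V}), h e`_i = k e`_i) -> h =1 k.
  move=> hl kl hk x.
  pose H := GRing.isLinear.Build F V F^o *%R h hl.
  pose K := GRing.isLinear.Build F V F^o *%R k kl.
  pose h' : {scalar V} := HB.pack h H.
  pose k' : {scalar V} := HB.pack k K.
  have -> : h x = h' x by [].
  have -> : k x = k' x by [].
  rewrite (coord_vbasis (memvf x)) !linear_sum.
  by apply: eq_bigr => i _; rewrite !scalarZ /= hk.
pose m w : 'rV[F]_(\dim {:V}) := \row_i g e`_i w.
have ml : linear m.
  by move=> a x y; apply/rowP => i; rewrite !mxE gr.
pose M := GRing.isLinear.Build F V _ _ m ml.
pose m' : {linear V -> 'rV[F]_(\dim {:V})} := HB.pack m M.
have kerm : lker (linfun m') == 0%VS.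
  rewrite -subv0; apply/subvP => x; rewrite memv_ker memv0 lfunE /= => /eqP mx0.
  have z_scalar : scalar (fun _ : V => 0 : F).
    by move=> a u v; rewrite mulr0 addr0.
  apply/eqP; apply: g0; apply: (form_eq (g^~ x) (fun=> 0)) => // i.
  by have /rowP/(_ i) := mx0; rewrite !mxE.
have imgm : limg (linfun m') = fullv.
  apply/eqP; rewrite eqEdim subvf /= limg_dim_eq; last first.
    by rewrite (eqP kerm) capv0.
  by rewrite dimvf /dim /= mul1n.
have /memv_imgP[w _ /rowP mw] : (\row_i f e`_i) \in limg (linfun m').
  by rewrite imgm memvf.
exists w; apply: form_eq => // i.
by have := mw i; rewrite lfunE /= !mxE.
Qed.

Lemma coord_inj (F : fieldType) (V : vectType F) (u v : V) :
  (forall i, coord (vbasis {:V}) i u = coord (vbasis {:V}) i v) -> u = v.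
Proof.
move=> uv; rewrite (coord_vbasis (memvf u)) (coord_vbasis (memvf v)).
by apply: eq_bigr => i _; rewrite uv.
Qed.

(** A vector identity is checked in each basis coordinate, where it becomes an identity of
    scalars. *)
Ltac module_ring :=
  apply: coord_inj => ?; rewrite !(linearD, linearN, linearZ, linear0) /=;
  first [ring | field].

(** * The imaginary subspace of a quadratic algebra *)

Section QuadraticAlgebra.
Variables (R : realType) (B : vectType R).
Variables (mul : {bilinear B -> B -> B}) (one : B).

Definition mulE :=
  (linearDl mul, linearBl mul, linearNl mul, linearZl_LR mul, linear0l mul,
   linearDr mul, linearBr mul, linearNr mul, linearZr_LR mul, linear0r mul).

Hypothesis quadB : quadratic_algebra mul one.

Let one0 : one != 0. Proof. by case: quadB. Qed.
Let m1x x : mul one x = x. Proof. by case: quadB => _ /(_ x)[]. Qed.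
Let mx1 x : mul x one = x. Proof. by case: quadB => _ /(_ x)[]. Qed.

Lemma quadratic_equation x : x \notin <[one]>%VS ->
  exists a r, mul x x = a *: x + r *: one.
Proof.
move=> xone; case: quadB => _ _ /(_ x).
rewrite (perm_free (_ : perm_eq _ [:: mul x x; x; one])); last first.
  by rewrite -[X in perm_eq _ X]/(rev [:: one; x; mul x x]) perm_sym perm_rev.
rewrite free_cons [free [:: x; one]]free_cons span_seq1 xone seq1_free one0 !andbT.
rewrite negbK span_cons span_seq1 => /memv_addP[_ /vlineP[a ->]].
by case=> _ /vlineP[r ->] ->; exists a, r.
Qed.

Lemma ImB_notin_line v : v \in ImB mul one -> v != 0 -> v \notin <[one]>%VS.
Proof. by rewrite inE => /orP[/andP[]//|->]. Qed.

Lemma ImB_sqr v : v \in ImB mul one -> exists r, mul v v = r *: one.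
Proof.
rewrite inE => /orP[/andP[_ /vlineP//]|/eqP->].
by exists 0; rewrite mulE scale0r.
Qed.

Lemma ImBI v r : v \notin <[one]>%VS -> mul v v = r *: one -> v \in ImB mul one.
Proof. by move=> vone vv; rewrite inE vone vv memvZ ?memv_line. Qed.

Lemma ImB0 : 0 \in ImB mul one.
Proof. by rewrite inE eqxx orbT. Qed.

Lemma ImBZ a v : v \in ImB mul one -> a *: v \in ImB mul one.
Proof.
move=> vI; have [->|a0] := eqVneq a 0; first by rewrite scale0r ImB0.
have [->|v0] := eqVneq v 0; first by rewrite scaler0 ImB0.
have [r vv] := ImB_sqr vI.
apply: (@ImBI _ (a * (a * r))); last by rewrite !mulE vv; module_ring.
apply: contra (ImB_notin_line vI v0) => /(memvZ a^-1).
by rewrite scalerA mulVf // scale1r.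
Qed.

(* When [one], [v], [w] are independent, the parallelogram law forces the linear
   coefficients of the quadratic equations of [v + w] and [v - w] to vanish. *)
Lemma ImBD v w : v \in ImB mul one -> w \in ImB mul one ->
  v + w \in ImB mul one.
Proof.
move=> vI wI.
have [->|v0] := eqVneq v 0; first by rewrite add0r.
have [->|w0] := eqVneq w 0; first by rewrite addr0.
have v1 := ImB_notin_line vI v0; have w1 := ImB_notin_line wI w0.
have [p vv] := ImB_sqr vI; have [q ww] := ImB_sqr wI.
have vindep a b : a *: v = b *: one -> a = 0.
  move=> ab; apply: contraNeq v1 => a0; apply/vlineP; exists (a^-1 * b).
  by rewrite -scalerA -ab scalerA mulVf ?scale1r.
have [/memv_addP[_ /vlineP[a ->]]|windep] := boolP (w \in <[v]> + <[one]>)%VS.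
  case=> _ /vlineP[b ->] wE.
  (* Squaring [w = a *: v + b *: one] puts [2ab v] on the line of [one], so [ab = 0]; and [a] is
     non-zero because [w] is off that line. *)
  have b0 : b = 0.
    have /vindep/eqP : (2 * (a * b)) *: v = (q - a * a * p - b * b) *: one.
      apply: (@addIr _ ((a * a * p + b * b) *: one)); rewrite -scalerDl.
      rewrite [X in _ = X *: _](_ : _ = q); last by ring.
      by rewrite -ww wE !mulE !m1x mx1 vv; module_ring.
    rewrite mulf_eq0 pnatr_eq0 /= mulf_eq0 /= => /orP[/eqP a0|/eqP//].
    by case/negP: w1; rewrite wE a0 scale0r add0r memvZ ?memv_line.
  by rewrite wE b0 scale0r addr0 -[X in X + _]scale1r -scalerDl ImBZ.
have windep' a b c : a *: w = b *: v + c *: one -> a = 0.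
  move=> abc; apply: contraNeq windep => a0.
  rewrite -[w](scale1r) -(mulVf a0) -scalerA abc memvZ //.
  by rewrite memv_add // memvZ // memv_line.
have notline e : e != 0 -> v + e *: w \notin <[one]>%VS.
  move=> e0; apply/vlineP => -[k vewk].
  case/eqP: e0; apply: (windep' _ (-1) k).
  by rewrite scaleN1r -vewk addKr.
have vw1 : v + w \notin <[one]>%VS by rewrite -[w]scale1r notline ?oner_eq0.
have vmw1 : v - w \notin <[one]>%VS.
  by rewrite -scaleN1r notline // oppr_eq0 oner_eq0.
have [a [r vpw]] := quadratic_equation vw1.
have [d [s vmw]] := quadratic_equation vmw1.
have sumE : (a - d) *: w = - (a + d) *: v + (2 * p + 2 * q - r - s) *: one.
  have -> : (a - d) *: w =
      (a *: (v + w) + r *: one) + (d *: (v - w) + s *: one)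
      - (a + d) *: v - (r + s) *: one by module_ring.
  by rewrite -vpw -vmw !mulE vv ww; module_ring.
have /eqP := windep' _ _ _ sumE; rewrite subr_eq0 => /eqP ad.
have a0 : a = 0.
  have : (a + a) *: v = (2 * p + 2 * q - r - s) *: one.
    have := sumE; rewrite -ad subrr scale0r => /esym/eqP.
    by rewrite scaleNr addrC subr_eq0 => /eqP.
  by move/vindep; lra.
by apply: (ImBI vw1 (r := r)); rewrite vpw a0 scale0r add0r.
Qed.

Lemma line_ImB a : a *: one \in ImB mul one -> a = 0.
Proof.
move=> aI; have [//|a0] := eqVneq a 0.
have := ImB_notin_line aI; rewrite scaler_eq0 negb_or a0 one0 => /(_ isT).
by rewrite memvZ ?memv_line.
Qed.

Lemma ImB_decomposition x : exists a, x - a *: one \in ImB mul one.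
Proof.
have [/vlineP[a ->]|x1] := boolP (x \in <[one]>%VS).
  by exists a; rewrite subrr ImB0.
(* Completing the square in [x^2 = a x + r one]. *)
have [a [r xx]] := quadratic_equation x1; exists (a / 2).
apply: (@ImBI _ (r + a / 2 * (a / 2))).
  by apply: contra x1 => /memvD/(_ (memvZ (a / 2) (memv_line one))); rewrite subrK.
rewrite !mulE !m1x !mx1 xx.
by module_ring.
Qed.

(** The form [t] reads off the coefficient of [one] along [ImB]. That coefficient is unique since
    [ImB] is a subspace meeting the line of [one] in 0, and uniqueness gives linearity. *)
Lemma trace_form : exists t : B -> R,
  [/\ scalar t, t one = 1 & forall x, (x \in ImB mul one) = (t x == 0)].
Proof.
pose t x := xchoose (ImB_decomposition x).
have tP x : x - t x *: one \in ImB mul one := xchooseP (ImB_decomposition x).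
have tE x a : x - a *: one \in ImB mul one -> t x = a.
  move=> xa; apply/eqP; rewrite -subr_eq0; apply/eqP; apply: line_ImB.
  have -> : (t x - a) *: one = (x - a *: one) + (-1) *: (x - t x *: one).
    by module_ring.
  by rewrite ImBD // ImBZ.
exists t; split=> [a x y||x].
- apply: tE.
  have -> : a *: x + y - (a * t x + t y) *: one =
            a *: (x - t x *: one) + (y - t y *: one) by module_ring.
  by rewrite ImBD // ImBZ.
- by apply: tE; rewrite scale1r subrr ImB0.
apply/idP/eqP => [xI|tx0]; first by apply: tE; rewrite scale0r subr0.
by have := tP x; rewrite tx0 scale0r subr0.
Qed.

(** * The Euclidean structure of a quadratic division algebra *)

Hypothesis divB : division_algebra mul.

Lemma division_integral x y : mul x y = 0 -> x = 0 \/ y = 0.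
Proof.
move=> xy0; have [|x0] := eqVneq x 0; [by left|right].
have [/bij_inj injx _] := divB x0.
by apply: injx; rewrite xy0 mulE.
Qed.

(** If [v^2 = r one] with [r >= 0], then [v^2 - r one] factors over the reals, and without zero
    divisors [v] would lie on the line of [one]. *)
Lemma ImB_sqr_neg v : v \in ImB mul one -> v != 0 ->
  exists2 q, 0 < q & mul v v = - q *: one.
Proof.
move=> vI v0; have v1 := ImB_notin_line vI v0.
have [r vv] := ImB_sqr vI; exists (- r); last by rewrite opprK.
rewrite oppr_gt0 ltNge; apply/negP => r_ge0.
have : mul (v - Num.sqrt r *: one) (v + Num.sqrt r *: one) = 0.
  rewrite !mulE !m1x !mx1 vv -[X in X *: one](sqr_sqrtr r_ge0).
  by module_ring.
case/division_integral => [/eqP|/eqP].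
  by rewrite subr_eq0 => /eqP vE; rewrite vE memvZ ?memv_line in v1.
by rewrite addr_eq0 => /eqP vE; rewrite vE memvN memvZ ?memv_line in v1.
Qed.

Lemma ImB_normalize v : v \in ImB mul one -> v != 0 ->
  exists s u, [/\ 0 < s, v = s *: u, u \in ImB mul one & mul u u = - one].
Proof.
move=> vI v0; have [q q0 vv] := ImB_sqr_neg vI v0.
have s0 : 0 < Num.sqrt q by rewrite sqrtr_gt0.
exists (Num.sqrt q), ((Num.sqrt q)^-1 *: v); split=> //.
- by rewrite scalerA divff ?scale1r // gt_eqF.
- exact: ImBZ.
rewrite !mulE vv !scalerA -[q in - q]sqr_sqrtr ?ltW //.
rewrite (_ : _ * _ = -1) ?scaleN1r //.
by field; rewrite gt_eqF.
Qed.

Lemma linear_form_onZ sigma a v : linear_form_on (ImB mul one) sigma ->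
  v \in ImB mul one -> sigma (a *: v) = a * sigma v.
Proof.
move=> sl vI; have s0 : sigma 0 = 0.
  by have := sl 1 0 0 ImB0 ImB0; rewrite scale1r addr0 mul1r; lra.
by have := sl a v 0 vI ImB0; rewrite addr0 s0 addr0.
Qed.

(* With [x = a one + v] and [v] imaginary, [2 t(x)^2 - t(x x) = a^2 - t(v v)],
   so polarizing it gives an inner product on [B] in which [one] is orthogonal
   to [ImB]; the form [sigma] is then the inner product with some [w]. *)
Lemma linear_form_on_max sigma : linear_form_on (ImB mul one) sigma ->
  (2 <= \dim {:B})%N ->
  exists S : R, is_max
    [set sigma x | x in [set x | x \in ImB mul one /\ mul x x = - one]] S.
Proof.
move=> sl dimB; have [t [tl t1 tI]] := trace_form.
pose tB := GRing.isLinear.Build R B R^o *%R t tl.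
pose t' : {scalar B} := HB.pack t tB.
have tD : {morph t : x y / x + y} := linearD t'.
have tZ a x : t (a *: x) = a * t x := scalarZ t' a x.
have tN x : t (- x) = - t x := linearN t' x.
have t0 : t 0 = 0 := linear0 t'.
pose g x y := 2 * (t x * t y) - (t (mul x y) + t (mul y x)) / 2.
have gC x y : g x y = g y x by rewrite /g; ring.
have gl y : scalar (g^~ y).
  by move=> a u v; rewrite /g !mulE !(tD, tZ); field.
have gr x : scalar (g x) by move=> a u v; rewrite -!(gC _ x) gl.
have imP x : x - t x *: one \in ImB mul one.
  by rewrite tI tD tN tZ t1 mulr1 subrr.
have gIm v (q : R) : v \in ImB mul one -> mul v v = - q *: one -> g v v = q.
  move=> + vv; rewrite tI => /eqP tv.
  by rewrite /g tv vv !tZ t1; field.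
have g0 x : g x x = 0 -> x = 0.
  have gE a v : v \in ImB mul one -> g (a *: one + v) (a *: one + v) = a ^+ 2 + g v v.
    rewrite tI => /eqP tv.
    by rewrite /g !mulE !m1x !mx1 !(tD, tZ) t1 tv; field.
  have -> : x = t x *: one + (x - t x *: one) by rewrite addrC subrK.
  rewrite gE //; have [->|v0] := eqVneq (x - t x *: one) 0.
    rewrite {1}/g mulE t0 !mulr0 addr0 mul0r subr0 addr0.
    by move/eqP; rewrite sqrf_eq0 => /eqP->; rewrite scale0r addr0.
  have [q q0 vv] := ImB_sqr_neg (imP x) v0.
  rewrite (gIm _ _ (imP x) vv) => gx0.
  by exfalso; have := sqr_ge0 (t x); lra.
(* The values of [sigma] off [ImB] are arbitrary, so it is first composed with the projection onto
   [ImB]. *)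
have [|w wP] := scalar_form_represented (f := fun x => sigma (x - t x *: one))
                  gl gr g0.
  move=> a x y; rewrite -sl ?imP //; congr sigma.
  by rewrite tl; module_ring.
have gw v : v \in ImB mul one -> sigma v = g v w.
  by move=> vI; rewrite -wP; move: vI; rewrite tI => /eqP->; rewrite scale0r subr0.
have sigma0 : sigma 0 = 0.
  by rewrite -[0](scale0r (0 : B)) linear_form_onZ ?mul0r ?ImB0.
have wI : w \in ImB mul one.
  have : g one w = 0 by rewrite -wP t1 scale1r subrr.
  by rewrite tI /g t1 !m1x !mx1 => gw0; apply/eqP; lra.
have [w0|w0] := eqVneq w 0.
  have gv0 v : g v w = 0 by rewrite w0 /g !mulE t0; field.
  (* Here [sigma] vanishes on [ImB], but the maximum 0 must be attained: dimension at least two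
     supplies an imaginary unit. *)
  have [v vI v0] : exists2 v, v \in ImB mul one & v != 0.
    have [x x1] : exists x, x \notin <[one]>%VS.
      have : ~~ ({:B} <= <[one]>)%VS.
        by apply/negP => /dimvS; rewrite dim_vline one0 leqNgt dimB.
      by case/subvPn => x _; exists x.
    exists (x - t x *: one); first exact: imP.
    by apply: contra x1; rewrite subr_eq0 => /eqP->; rewrite memvZ ?memv_line.
  have [s [u [s0 _ uI uu]]] := ImB_normalize vI v0.
  exists 0; split; first by exists u; rewrite // gw.
  by move=> _ [x [xI _] <-]; rewrite gw // gv0.
have [s [u [s0 wE uI uu]]] := ImB_normalize wI w0.
have unit_g x : x \in ImB mul one -> mul x x = - one -> g x x = 1.
  by move=> xI xx; apply: gIm; rewrite // scaleN1r.
have sigmaE x : x \in ImB mul one -> sigma x = s * g x u.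
  move=> xI; rewrite gw // wE gC -[s *: u]addr0 gl (gC u).
  by rewrite {2}/g !mulE t0; field.
exists s; split; first by exists u; rewrite // sigmaE // unit_g ?mulr1.
move=> _ [x [xI xx] <-]; rewrite sigmaE //.
(* Cauchy-Schwarz for unit vectors: [0 <= g (x - u) (x - u) = 2 - 2 g x u]. *)
have [q q0 gq] : exists2 q, 0 <= q & g (x - u) (x - u) = q.
  have xuI : x - u \in ImB mul one by rewrite -scaleN1r ImBD // ImBZ.
  have [xu0|xu0] := eqVneq (x - u) 0.
    by exists 0; rewrite ?xu0 // /g mulE t0; field.
  by have [q /ltW] := ImB_sqr_neg xuI xu0; exists q; rewrite // (gIm _ q).
have gxu : g (x - u) (x - u) = g x x + g u u - 2 * g x u.
  by rewrite /g !mulE !(tD, tN); field.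
by rewrite gq (unit_g x) // (unit_g u) // in gxu; nra.
Qed.

(** * Idempotents of the planar isotope *)

Variables (T : 'End(B)) (sigma : B -> R) (lambda : R).
Hypothesis sl : linear_form_on (ImB mul one) sigma.
Hypothesis lambda0 : lambda != 0.
Hypothesis Tdet : determined_by mul one T sigma lambda.

Lemma isotope_sqr a s u : u \in ImB mul one -> mul u u = - one ->
  planar_isotope mul T (a *: one + s *: u) (a *: one + s *: u) =
  ((a + s * sigma u) ^+ 2 - (lambda * s) ^+ 2) *: one
  + (2 * (a + s * sigma u) * lambda * s) *: u.
Proof.
move=> uI uu; case: Tdet => T1 TI.
rewrite /planar_isotope /= /isotope_mul linearD !linearZ /= T1 TI //.
by rewrite !mulE !m1x !mx1 uu; module_ring.
Qed.

Lemma isotope_one : nonzero_idempotent (planar_isotope mul T) one.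
Proof.
split=> //; case: Tdet => T1 _.
by rewrite /planar_isotope /= /isotope_mul T1 m1x.
Qed.

Lemma coef_inj u a b c d : u \notin <[one]>%VS ->
  a *: one + b *: u = c *: one + d *: u -> a = c /\ b = d.
Proof.
move=> u1 E.
have E' : (b - d) *: u = (c - a) *: one.
  have -> : (b - d) *: u = (a *: one + b *: u) - a *: one - d *: u by module_ring.
  by rewrite E; module_ring.
have bd : b - d = 0.
  apply: contraNeq u1 => bd; apply/vlineP; exists ((b - d)^-1 * (c - a)).
  by rewrite -scalerA -E' scalerA mulVf ?scale1r.
move/eqP: E'; rewrite bd scale0r eq_sym scaler_eq0 (negPf one0) orbF.
by move/eqP => ca; split; lra.
Qed.

Lemma unit_notin_line u : mul u u = - one -> u \in ImB mul one ->
  u \notin <[one]>%VS.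
Proof.
move=> uu uI; apply: ImB_notin_line => //; apply/eqP => u0.
by move/eqP: uu; rewrite u0 mulE eq_sym oppr_eq0 (negPf one0).
Qed.

(* The non-zero roots [s] of this quadratic give the idempotents of the isotope
   in the plane spanned by [one] and [u] that lie off the line of [one]. *)
Lemma isotope_idempotentP a s u : u \in ImB mul one -> mul u u = - one ->
  s != 0 ->
  planar_isotope mul T (a *: one + s *: u) (a *: one + s *: u)
    = a *: one + s *: u <->
  a = (2 * lambda)^-1 - s * sigma u /\
  (2 * lambda ^+ 2 * s - sigma u) ^+ 2 = sigma u ^+ 2 + 1 - 2 * lambda.
Proof.
move=> uI uu s0; rewrite isotope_sqr //; split; last first.
  move=> [-> sE]; congr (_ *: _ + _ *: _); last by field.
  apply: (mulfI (_ : 4 * lambda ^+ 2 != 0)).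
    by rewrite mulf_neq0 ?pnatr_eq0 ?expf_neq0.
  rewrite -[LHS]addr0 -(subrr (sigma u ^+ 2 + 1 - 2 * lambda)) -{1}sE.
  by field.
case/(coef_inj (unit_notin_line uu uI)) => aE sE.
(* The coefficient of [u], divided by [s], determines [a]. *)
have bE : a + s * sigma u = (2 * lambda)^-1.
  apply: (mulfI (_ : 2 * lambda * s != 0)).
    by rewrite !mulf_neq0 ?pnatr_eq0.
  by transitivity s; [rewrite -[RHS]sE; ring|field].
split; first by rewrite -bE addrK.
rewrite bE in aE.
have {}aE : (lambda * s) ^+ 2 - s * sigma u = (2 * lambda)^-1 ^+ 2 - (2 * lambda)^-1.
  by move: aE bE; set b := _^-1; lra.
(* The coefficient of [one], multiplied by [4 lambda^2], is completed to a square. *)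
transitivity (4 * lambda ^+ 2 * ((lambda * s) ^+ 2 - s * sigma u) + sigma u ^+ 2).
  by ring.
by rewrite aE; field.
Qed.

Lemma unique_isotope_idempotentP S : is_max
    [set sigma x | x in [set x | x \in ImB mul one /\ mul x x = - one]] S ->
  (exists! x : B, nonzero_idempotent (planar_isotope mul T) x) <->
  (lambda > (S ^+ 2 + 1) / 2 \/ (S = 0 /\ lambda = 1 / 2)).
Proof.
move=> [[u [uI uu] uS] Smax].
(* The imaginary units are stable under negation. *)
have S_bound x : x \in ImB mul one -> mul x x = - one -> - S <= sigma x <= S.
  move=> xI xx; rewrite lerNl -mulN1r -linear_form_onZ //.
  apply/andP; split; apply: Smax; last by exists x.
  by exists (- 1 *: x); split; rewrite ?ImBZ // !mulE xx !scaleN1r opprK.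
have S_ge0 : 0 <= S by have /andP[] := S_bound u uI uu; rewrite uS; lra.
have off_line x s a : s != 0 -> x \in ImB mul one -> mul x x = - one ->
    a *: one + s *: x \notin <[one]>%VS.
  move=> s0 xI xx; apply: contra (unit_notin_line xx xI) => /vlineP[k E].
  apply/vlineP; exists (s^-1 * (k - a)); rewrite -scalerA scalerBl -E.
  by rewrite addrAC subrr add0r scalerA mulVf ?scale1r.
split=> [[x0 [_ x0_uniq]]|cond].
  have [|lam_le] := ltP ((S ^+ 2 + 1) / 2) lambda; [by left|right].
  have D_ge0 : 0 <= S ^+ 2 + 1 - 2 * lambda by lra.
  (* The larger root for the unit [u] attaining [S]. As [S >= 0], it vanishes only if both [S] and
     the discriminant do, which is the exceptional case. *)
  pose s := (S + Num.sqrt (S ^+ 2 + 1 - 2 * lambda)) / (2 * lambda ^+ 2).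
  have rootE : 2 * lambda ^+ 2 * s = S + Num.sqrt (S ^+ 2 + 1 - 2 * lambda).
    by rewrite /s; field.
  have sqrt_ge0 := sqrtr_ge0 (S ^+ 2 + 1 - 2 * lambda).
  have [s0|s0] := eqVneq s 0.
    rewrite s0 mulr0 in rootE.
    have S0 : S = 0 by lra.
    have /eqP : Num.sqrt (S ^+ 2 + 1 - 2 * lambda) = 0 by lra.
    by rewrite sqrtr_eq0 S0; split=> //; nra.
  pose a := (2 * lambda)^-1 - s * S.
  have y1 := off_line u s a s0 uI uu.
  (* Uniqueness would identify this idempotent with [one], although it is off the line of [one]. *)
  case/negP: (y1); rewrite -(x0_uniq (a *: one + s *: u)).
    by rewrite (x0_uniq one isotope_one) memv_line.
  split; first by apply: contra y1 => /eqP->; rewrite mem0v.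
  apply/isotope_idempotentP => //; rewrite uS; split=> //.
  by rewrite rootE addrAC subrr add0r sqr_sqrtr.
exists one; split; first exact: isotope_one.
move=> x [x0 xx].
have [a vI] := ImB_decomposition x.
have xE : x = a *: one + (x - a *: one) by rewrite addrC subrK.
(* On the line of [one] idempotency reads [a^2 = a]; off it, the root criterion applies. *)
have [v0|v0] := eqVneq (x - a *: one) 0.
  rewrite v0 addr0 in xE; move: xx; rewrite xE.
  case: Tdet => T1 _; rewrite /planar_isotope /= /isotope_mul !linearZ /= T1.
  rewrite !mulE m1x scalerA => /eqP; rewrite -subr_eq0 -scalerBl scaler_eq0.
  rewrite (negPf one0) orbF => aa; have [a0|a0] := eqVneq a 0.
    by move: x0; rewrite xE a0 scale0r eqxx.
  by rewrite (_ : a = 1) ?scale1r //; apply: (mulfI a0); lra.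
have [s [y [s_gt0 vE yI yy]]] := ImB_normalize vI v0.
have s0 : s != 0 by rewrite gt_eqF.
have [_ rootE] : a = (2 * lambda)^-1 - s * sigma y /\ 
    (2 * lambda ^+ 2 * s - sigma y) ^+ 2 = sigma y ^+ 2 + 1 - 2 * lambda.
  by apply/isotope_idempotentP => //; rewrite -vE -xE.
have /andP[NSy yS] := S_bound y yI yy.
have D_ge0 : 0 <= sigma y ^+ 2 + 1 - 2 * lambda by rewrite -rootE sqr_ge0.
case: cond => [lam|[S0 lam]].
  (* From [|sigma y| <= S], a non-negative discriminant yields [2 lambda <= S^2 + 1]. *)
  have : 0 <= (S - sigma y) * (S + sigma y) by apply: mulr_ge0; lra.
  rewrite -subr_sqr => ?; have : lambda <= (S ^+ 2 + 1) / 2 by lra.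
  by rewrite leNgt lam.
have sy0 : sigma y = 0 by lra.
(* In the exceptional case 0 is a double root, contrary to [s != 0]. *)
have /eqP : (2 * lambda ^+ 2 * s) ^+ 2 = 0.
  by rewrite -[_ * s]subr0 -sy0 rootE sy0 lam; field.
by rewrite sqrf_eq0 !mulf_eq0 pnatr_eq0 (negPf lambda0) (negPf s0).
Qed.

End QuadraticAlgebra.

Theorem proposition15 (R : realType) (B : vectType R)
    (mul : {bilinear B -> B -> B}) (one : B)
    (T : 'End(B)) (sigma : B -> R) (lambda : R) :
  quadratic_algebra mul one ->
  division_algebra mul ->
  (2 <= \dim {:B})%N ->
  planar mul one T ->
  linear_form_on (ImB mul one) sigma ->
  lambda != 0 ->
  determined_by mul one T sigma lambda ->
  exists2 S : R,
    is_max [set sigma x | x in [set x | x \in ImB mul one /\ mul x x = - one]] S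
    & ((exists! x : B, nonzero_idempotent (planar_isotope mul T) x) <->
       (lambda > (S ^+ 2 + 1) / 2 \/ (S = 0 /\ lambda = 1 / 2))).
Proof.
move=> quadB divB dimB _ sl lambda0 Tdet.
have [S Smax] := linear_form_on_max quadB divB sl dimB.
by exists S => //; exact: (unique_isotope_idempotentP quadB divB sl lambda0 Tdet Smax).
Qed.
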